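(* Let $G$ be a finite graph. Then the combinatorial Alexander dual $\mathcal{I}(\mathcal{N}_G)^\vee$ of the independence complex of the neighborhood hypergraph $\mathcal{N}_G$ coincides with the closed neighborhood complex $\mathcal{N}[\overline{G}]$.
   Context: A finite graph $G$ is a finite set $V(G)$ with a symmetric irreflexive edge relation; $\overline G$ is its complement graph. The open neighborhood of $v$ is $N_G(v)=\{w:(v,w)\in E(G)\}$ and the closed neighborhood is $N_G[v]=N_G(v)\cup\{v\}$. The closed neighborhood complex $\mathcal{N}[H]$ of a graph $H$ is the simplicial complex on $V(H)$ whose simplices are the subsets $\sigma$ with $\sigma\subset N_H[v]$ for some $v\in V(H)$. A hypergraph $H$ is a pair of a finite set $V(H)$ and a family $E(H)$ of subsets of $V(H)$; a subset $\sigma\subset V(H)$ is independent if no $e\in E(H)$ satisfies $e\subset\sigma$, and the independence complex $\mathcal{I}(H)$ is the simplicial complex on $V(H)$ of independent sets. The neighborhood hypergraph $\mathcal{N}_G$ has vertex set $V(G)$ and hyperedges $\{N_G(v):v\in V(G)\}$. For a simplicial complex $K$ on a finite ground set $X$, its combinatorial Alexander dual is $K^\vee=\{\sigma\subset X : X\setminus\sigma\notin K\}$, a simplicial complex on $X$. Simplicial complexes are regarded as families of subsets (containing $\emptyset$), and ''coincides'' means equality of these families. *)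

(* Defs.v *)
From mathcomp Require Import all_boot.
Set Implicit Arguments.
Unset Strict Implicit.
Unset Printing Implicit Defensive.

Record graph := Graph {
  vertex : finType;
  edge : rel vertex;
  edge_sym : symmetric edge;
  edge_irrefl : irreflexive edge
}.

Section GraphTheory.
Variable G : graph.

Definition open_nbhd (v : vertex G) : {set vertex G} := [set w | edge v w].

Definition closed_nbhd (v : vertex G) : {set vertex G} := v |: open_nbhd v.

Definition compl_edge : rel (vertex G) :=
  [rel v w | (v != w) && ~~ edge v w].

Lemma compl_edge_sym : symmetric compl_edge.
Proof. by move=> v w; rewrite /compl_edge /= eq_sym edge_sym. Qed.

Lemma compl_edge_irrefl : irreflexive compl_edge.
Proof. by move=> v; rewrite /compl_edge /= eqxx. Qed.

Definition compl_graph : graph := Graph compl_edge_sym compl_edge_irrefl.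

End GraphTheory.

(* The ground set is the whole type T, but singletons need not be faces.
   The void complex (no face at all, not even set0) is allowed: it is the
   independence complex of a hypergraph having set0 as a hyperedge. *)
Record complex (T : finType) := Complex {
  faces : {set {set T}};
  faces_down : forall s t : {set T}, t \subset s -> s \in faces -> t \in faces
}.

Section AlexanderDual.
Variables (T : finType) (K : complex T).

Definition dual_faces : {set {set T}} := [set s : {set T} | ~: s \notin faces K].

Lemma dual_faces_down (s t : {set T}) :
  t \subset s -> s \in dual_faces -> t \in dual_faces.
Proof.
rewrite !inE => ts; apply: contra; apply: faces_down.
by rewrite setCS.
Qed.

Definition alexander_dual : complex T := Complex dual_faces_down.

End AlexanderDual.

Record hypergraph := Hypergraph {
  hvertex : finType;
  hedges : {set {set hvertex}}
}.

Section IndependenceComplex.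
Variable H : hypergraph.

Definition independent (s : {set hvertex H}) : bool :=
  ~~ [exists e in hedges H, e \subset s].

Definition independent_sets : {set {set hvertex H}} :=
  [set s : {set hvertex H} | independent s].

Lemma independent_sets_down (s t : {set hvertex H}) :
  t \subset s -> s \in independent_sets -> t \in independent_sets.
Proof.
rewrite !inE => ts; apply: contra => /exists_inP[e He et].
by apply/exists_inP; exists e => //; apply: subset_trans ts.
Qed.

Definition independence_complex : complex (hvertex H) :=
  Complex independent_sets_down.

End IndependenceComplex.

Definition nbhd_hypergraph (G : graph) : hypergraph :=
  Hypergraph [set open_nbhd v | v : vertex G].

Section ClosedNbhdComplex.
Variable G : graph.

Definition closed_nbhd_faces : {set {set vertex G}} :=
  [set s : {set vertex G} | [exists v : vertex G, s \subset closed_nbhd v]].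

Lemma closed_nbhd_faces_down (s t : {set vertex G}) :
  t \subset s -> s \in closed_nbhd_faces -> t \in closed_nbhd_faces.
Proof.
rewrite !inE => ts /existsP[v sv].
by apply/existsP; exists v; apply: subset_trans sv.
Qed.

Definition closed_nbhd_complex : complex (vertex G) :=
  Complex closed_nbhd_faces_down.

End ClosedNbhdComplex.

(* Main.v *)
(** A closed neighborhood of the complement graph is the complement of an open
    neighborhood of [G], so [~: s] contains some [open_nbhd v] iff [s] is
    contained in some closed neighborhood of the complement graph. *)
Require Import Defs.
From mathcomp Require Import all_boot.

(** Away from [v], adjacency in the complement is non-adjacency in [G]; [v] itself lies on both
    sides because [edge] is irreflexive. *)
Lemma closed_nbhd_compl_graph (G : graph) (v : vertex G) :
  closed_nbhd (v : vertex (compl_graph G)) = ~: open_nbhd v :> {set vertex G}.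
Proof.
apply/setP=> w; rewrite !inE /= /compl_edge /= eq_sym.
by case: (eqVneq v w) => [<-|_] /=; rewrite ?edge_irrefl.
Qed.

Theorem theorem1p4 (G : graph) :
  faces (alexander_dual (independence_complex (nbhd_hypergraph G))) =
  faces (closed_nbhd_complex (compl_graph G)) :> {set {set vertex G}}.
Proof.
(* The dual and [independent] contribute one negation each; they cancel, leaving that [~: s]
   contains a hyperedge. *)
apply/setP=> s; rewrite !inE negbK.
apply/exists_inP/existsP => [[_ /imsetP[v _ ->] vs]|[v sv]].
  by exists v; rewrite closed_nbhd_compl_graph -setCS setCK.
(* The cast reads [v], a vertex of the complement graph, as a vertex of [G]. *)
exists (open_nbhd (v : vertex G)); first exact: imset_f.
by rewrite -setCS setCK -closed_nbhd_compl_graph.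
Qed.
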